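(* Let $(X,d)$ be a complete separable metric space (Polish space), let $\alpha^0:\Omega\to[0,+\infty)$ be a random variable on the probability space $(\Omega,\mathcal{F},P)$ such that $0\le\alpha^0<1$ a.s., and let $T:\Omega\times X\to CB(X)$ be a multivalued random operator. Suppose that the following conditions are satisfied: (1) there exists $\Omega_0\in\mathcal{F}$ with $P(\Omega_0)=1$ such that $T(\omega,\cdot):(X,d)\to(CB(X),h)$ is continuous for each $\omega\in\Omega_0$; (2) $P(\Omega(x,y))=1$ for any $(x,y)\in X\times X$, where $\Omega(x,y)=\{\omega\in\Omega: h(T(\omega,x),T(\omega,y))\le\alpha^0(\omega)d(x,y)\}$ is assumed to be $\mathcal{F}$-measurable. Then there exists a random element $x^0:(\Omega,\mathcal{F},P)\to(X,d)$ such that $x^0(\omega)\in T(\omega,x^0(\omega))$ for almost all $\omega\in\Omega$.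
   Context: $CB(X)$ is the family of nonempty bounded closed subsets of $X$ and $h$ is the classical Hausdorff metric on $CB(X)$. A multivalued function $V:\Omega\to 2^X$ is measurable if $V^{-1}(G):=\{\omega\in\Omega:V(\omega)\cap G\ne\emptyset\}\in\mathcal{F}$ for every open $G\subset X$. A mapping $T:\Omega\times X\to 2^X$ is a multivalued random operator if $T(\cdot,x):\Omega\to 2^X$ is measurable for each $x\in X$. A mapping $V:\Omega\to X$ is a random element if $V^{-1}(G)\in\mathcal{F}$ for every open $G\subset X$. *)

(* Defs.v *)
From HB Require Import structures.
From mathcomp Require Import all_boot all_order all_algebra.
From mathcomp Require Import all_classical all_reals all_analysis.

Set Implicit Arguments.
Unset Strict Implicit.
Unset Printing Implicit Defensive.

Import Order.TTheory GRing.Theory Num.Theory.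

Local Open Scope classical_set_scope.
Local Open Scope ring_scope.

(* [Complete] includes [isPointed], so these spaces are nonempty. *)
#[short(type="completeMetricType")]
HB.structure Definition CompleteMetric (R : numDomainType) :=
  { M of CompletePseudoMetric R M & PseudoMetric_isMetric R M }.

Definition separable (X : topologicalType) : Prop :=
  exists2 D : set X, countable D & dense D.

Definition mbounded (R : realType) (X : metricType R) (A : set X) : Prop :=
  exists M : R, forall x y, A x -> A y -> mdist x y <= M.

Record CB (R : realType) (X : metricType R) := MkCB {
  CB_set :> set X ;
  CB_neq0 : CB_set !=set0 ;
  CB_bounded : mbounded CB_set ;
  CB_closed : closed CB_set }.

Definition dist_set (R : realType) (X : metricType R) (x : X) (A : set X) : R :=
  inf [set mdist x a | a in A].

Definition excess (R : realType) (X : metricType R) (A B : set X) : R :=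
  sup [set dist_set a B | a in A].

(* [inf] and [sup] are total with junk values, so [hausdorff_dist] is the
   Hausdorff distance only between nonempty bounded sets. *)
Definition hausdorff_dist (R : realType) (X : metricType R) (A B : set X) : R :=
  Num.max (excess A B) (excess B A).

Section hausdorff_metric.
Context {R : realType} {X : metricType R}.
Implicit Types (x y : X) (S : set X) (A B C : CB X).

Lemma CB_eq A B : CB_set A = CB_set B -> A = B.
Proof.
case: A B => [A A1 A2 A3] [B B1 B2 B3] /= AB; subst B.
by congr MkCB; exact: Prop_irrelevance.
Qed.

Lemma dist_set_has_inf x S : S !=set0 -> has_inf [set mdist x a | a in S].
Proof.
move=> [a Sa]; split; first by exists (mdist x a), a.
by exists 0 => _ [b _ <-]; exact: mdist_ge0.
Qed.

Lemma dist_set_ge0 x S : S !=set0 -> 0 <= dist_set x S.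
Proof.
move=> S0; apply: lb_le_inf; first exact: (dist_set_has_inf x S0).1.
by move=> _ [b _ <-]; exact: mdist_ge0.
Qed.

Lemma dist_set_le x S a : S a -> dist_set x S <= mdist x a.
Proof.
move=> Sa; apply: ge_inf; last by exists a.
by exists 0 => _ [b _ <-]; exact: mdist_ge0.
Qed.

Lemma dist_set_ge x S r :
  S !=set0 -> (forall a, S a -> r <= mdist x a) -> r <= dist_set x S.
Proof.
move=> S0 rS; apply: lb_le_inf; first exact: (dist_set_has_inf x S0).1.
by move=> _ [b Sb <-]; exact: rS.
Qed.

Lemma dist_set_triangle x y S : S !=set0 ->
  dist_set x S <= mdist x y + dist_set y S.
Proof.
move=> S0; rewrite -lerBlDl; apply: dist_set_ge => // a Sa.
rewrite lerBlDl; apply: le_trans (metric_triangle x y a).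
exact: dist_set_le.
Qed.

Lemma dist_set_closed x S : S !=set0 -> closed S -> dist_set x S <= 0 -> S x.
Proof.
move=> S0 cS xS; apply: cS => U /nbhs_ballP[e /= e0 xU].
have [_ [a Sa <-] xae] := inf_adherent e0 (dist_set_has_inf x S0).
exists a; split => //; apply: xU; rewrite ballEmdist /=.
by apply: lt_le_trans xae _; rewrite gerDr.
Qed.

Lemma excess_has_sup A B : has_sup [set dist_set a B | a in CB_set A].
Proof.
have [a Aa] := CB_neq0 A; have [b Bb] := CB_neq0 B.
have [M AM] := CB_bounded A.
split; first by exists (dist_set a B), a.
exists (M + mdist a b) => _ [c Ac <-].
apply: le_trans (dist_set_le _ Bb) _.
by apply: le_trans (metric_triangle c a b) _; rewrite lerD2r AM.
Qed.

Lemma excess_ge A B a : CB_set A a -> dist_set a B <= excess A B.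
Proof.
by move=> Aa; apply: ub_le_sup; [exact: (excess_has_sup A B).2|exists a].
Qed.

Lemma excess_le A B r :
  (forall a, CB_set A a -> dist_set a B <= r) -> excess A B <= r.
Proof.
move=> Ar; apply: ge_sup; first exact: (excess_has_sup A B).1.
by move=> _ [a Aa <-]; exact: Ar.
Qed.

Lemma excess_triangle A B C : excess A C <= excess A B + excess B C.
Proof.
apply: excess_le => a Aa; apply: (@le_trans _ _ (dist_set a B + excess B C)).
  rewrite -lerBlDr; apply: dist_set_ge; first exact: CB_neq0.
  move=> b Bb; rewrite lerBlDr.
  apply: le_trans (dist_set_triangle a b (CB_neq0 C)) _.
  by rewrite lerD2l excess_ge.
by rewrite lerD2r excess_ge.
Qed.

Lemma excess_subset A B : excess A B <= 0 -> CB_set A `<=` CB_set B.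
Proof.
move=> AB a Aa; apply: dist_set_closed; [exact: CB_neq0|exact: CB_closed|].
exact: le_trans (excess_ge B Aa) AB.
Qed.

Lemma excessxx A : excess A A = 0.
Proof.
have [a Aa] := CB_neq0 A; apply/eqP; rewrite eq_le; apply/andP; split.
  by apply: excess_le => b Ab; rewrite -(mdistxx b) dist_set_le.
exact: le_trans (dist_set_ge0 a (CB_neq0 A)) (excess_ge A Aa).
Qed.

Definition CB_dist A B : R := hausdorff_dist A B.

Lemma CB_distxx A : CB_dist A A = 0.
Proof. by rewrite /CB_dist /hausdorff_dist excessxx maxxx. Qed.

Lemma CB_dist_positivity A B : CB_dist A B = 0 -> A = B.
Proof.
move=> AB0; have : CB_dist A B <= 0 by rewrite AB0.
rewrite /CB_dist /hausdorff_dist ge_max => /andP[AB BA].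
by apply/CB_eq/seteqP; split; exact: excess_subset.
Qed.

Lemma CB_dist_sym A B : CB_dist A B = CB_dist B A.
Proof. by rewrite /CB_dist /hausdorff_dist maxC. Qed.

Lemma CB_dist_triangle B A C : CB_dist A C <= CB_dist A B + CB_dist B C.
Proof.
rewrite /CB_dist /hausdorff_dist ge_max; apply/andP; split.
  apply: le_trans (excess_triangle A B C) _.
  by rewrite lerD // le_max lexx.
apply: le_trans (excess_triangle C B A) _.
by rewrite addrC lerD // le_max lexx orbT.
Qed.

End hausdorff_metric.

HB.instance Definition _ (R : realType) (X : metricType R) :=
  gen_eqMixin (CB X).
HB.instance Definition _ (R : realType) (X : metricType R) :=
  gen_choiceMixin (CB X).
HB.instance Definition _ (R : realType) (X : metricType R) :=
  isMetric.Build R (CB X) CB_distxx CB_dist_positivity CB_dist_sym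
    CB_dist_triangle.

Lemma mdist_CBE (R : realType) (X : metricType R) (A B : CB X) :
  mdist A B = hausdorff_dist A B.
Proof. by []. Qed.

Definition multi_measurable (d : measure_display) (Omega : measurableType d)
    (X : topologicalType) (V : Omega -> set X) : Prop :=
  forall G : set X, open G -> measurable [set w | V w `&` G !=set0].

Definition multi_random_operator (d : measure_display)
    (Omega : measurableType d) (X : topologicalType)
    (T : Omega -> X -> set X) : Prop :=
  forall x : X, multi_measurable (fun w => T w x).

Definition random_element (d : measure_display) (Omega : measurableType d)
    (X : topologicalType) (V : Omega -> X) : Prop :=
  forall G : set X, open G -> measurable (V @^-1` G).

(* Main.v *)
Require Import Defs.
From HB Require Import structures.
From mathcomp Require Import all_boot all_order all_algebra.
From mathcomp Require Import all_classical all_reals all_analysis.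
From mathcomp Require Import measurable_realfun ring lra.

Set Implicit Arguments.
Unset Strict Implicit.
Unset Printing Implicit Defensive.

Import Order.TTheory GRing.Theory Num.Theory.
Import numFieldNormedType.Exports.

Local Open Scope classical_set_scope.
Local Open Scope ring_scope.

(** A set-valued contraction of a complete space has a fixed point because a
    Picard iteration, each term lying nearly in the image of the previous one,
    has geometrically decreasing steps.  The difficulty here is to run that
    iteration measurably in [w].  Choosing the next point inside [T w x] would
    call for a measurable selection theorem, so the iterates are confined to
    one fixed dense sequence [q] and the condition to be in the image is
    replaced by a bound on [gap (T w) x], the distance from [x] to [T w x].

    Let [a < 1] be the contraction constant, [b] the midpoint of [a] and [1],
    and [c > gap (T w) (q 0)].  If [gap (T w) x < c * b ^+ n], some point [y]
    of [T w x] is at distance less than [c * b ^+ n] from [x], and its own gap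
    is at most [a * mdist x y], hence less than [c * b ^+ n.+1].  Since the gap
    is continuous, [y] may be replaced by a nearby [q k] with both strict
    bounds preserved ([picard_step]); taking the least such [k] makes the
    index a measurable function of [w], because for fixed [k] the function
    [w |-> gap (T w) (q k)] is measurable ([measurable_gap]).  The steps are
    dominated by a geometric series and the gaps tend to [0], so the iterates
    converge to a point of gap [0], that is, to a fixed point
    ([picard_lim_fixed]); the limit is a random element as a pointwise limit
    of random elements ([random_element_cvg]).

    The contraction inequality holds almost surely for each pair of points,
    with an exceptional set depending on the pair.  The countably many pairs
    taken from [q] share one null set, and off it continuity of [T w] extends
    the inequality to all pairs ([lipschitz_dense]). *)

(** * Metric spaces *)

Section metric_spaces.
Context {R : realType} {X : metricType R}.
Implicit Types (x y z : X) (q : nat -> X).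

Definition dense_seq q :=
  forall x (e : R), 0 < e -> exists k, mdist x (q k) < e.

Lemma open_mdist_ball x (r : R) : open (ball x r).
Proof.
rewrite openE => y; rewrite ballEmdist /= => xyr.
apply/nbhs_ballP; exists (r - mdist x y); first by rewrite /= subr_gt0.
move=> z; rewrite !ballEmdist /= => yz.
by have := metric_triangle x y z; lra.
Qed.

Lemma cvg_mdist_exists (u : nat -> X) x (e : R) :
  u n @[n --> \oo] --> x -> 0 < e ->
  exists N, forall n, (N <= n)%N -> mdist x (u n) < e.
Proof.
move=> ux e0.
by have [N _ uN] := metricType_numDomainType.cvgr_dist_lt ux e0; exists N.
Qed.

(** Both sides of the inequality are continuous in the pair of points. *)
Lemma lipschitz_dense (Y : metricType R) (f : X -> Y) (a : R) q :
  0 <= a -> dense_seq q -> continuous f ->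
  (forall i j, mdist (f (q i)) (f (q j)) <= a * mdist (q i) (q j)) ->
  forall x y, mdist (f x) (f y) <= a * mdist x y.
Proof.
move=> a0 qd fc fq x y; apply/ler_addgt0Pr => e e0.
have approx z (r : R) : 0 < r ->
    exists k, mdist z (q k) < r /\ mdist (f z) (f (q k)) < r.
  move=> r0; have [s s0 sf] : nbhs_ball z (fun t => mdist (f z) (f t) < r).
    by apply/nbhs_ballP; exact: (metricType_numDomainType.cvgr_dist_lt (fc z)).
  have [|k] := qd z (Num.min r s); first by rewrite lt_min r0.
  rewrite lt_min => /andP[zr zs]; exists k; split => //.
  by apply: sf; rewrite ballEmdist.
(* Replacing [x] and [y] by terms of [q] so close that the images also move by
   less than [r] costs [2 * r] on the left-hand side and [a * (2 * r)] on the
   right-hand side. *)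
have r0 : 0 < e / (2 * (a + 1)) by rewrite divr_gt0 // mulr_gt0 //; lra.
have eE : e = 2 * (a + 1) * (e / (2 * (a + 1))) by field; lra.
move: (e / _) r0 eE => r r0 ->.
have [i [xi fxi]] := approx x r r0; have [j [yj fyj]] := approx y r r0.
have qij : mdist (q i) (q j) <= 2 * r + mdist x y.
  have := metric_triangle (q i) x (q j); have := metric_triangle x y (q j).
  by rewrite (metric_sym (q i) x); lra.
have := metric_triangle (f x) (f (q i)) (f y).
have := metric_triangle (f (q i)) (f (q j)) (f y).
rewrite (metric_sym (f (q j)) (f y)).
have := fq i j; have := ler_wpM2l a0 qij; lra.
Qed.

End metric_spaces.

Lemma separable_dense_seq (R : realType) (X : completeMetricType R) :
  separable X -> exists q : nat -> X, dense_seq q.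
Proof.
move=> [D cD dD]; have [D0|[q]] := pfcard_geP cD.
  by have [|x []] := dD setT _ openT; [exists point|rewrite D0].
exists q => x e e0.
have [|y [xy Dy]] := dD (ball x e) _ (open_mdist_ball x e).
  by exists x; exact: ballxx.
have [k _ qk] := @surj _ _ _ _ q y Dy.
by exists k; rewrite qk; move: xy; rewrite ballEmdist.
Qed.

Lemma geometric_steps_cvg (R : realType) (X : completeMetricType R)
    (u : nat -> X) (b c : R) : 0 <= b < 1 ->
  (forall n, mdist (u n) (u n.+1) <= c * b ^+ n) -> cvg (u n @[n --> \oo]).
Proof.
move=> /andP[b0 b1] ub; apply: cauchy_cvg; apply: cauchy_exP => e e0.
have tail n k : mdist (u n) (u (n + k)%N) <= c * b ^+ n / (1 - b).
  have c0 : 0 <= c.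
    by apply: le_trans (mdist_ge0 _ _) _; rewrite -[c]mulr1; exact: ub 0%N.
  elim: k n => [|k IH] n.
    by rewrite addn0 mdistxx divr_ge0 ?mulr_ge0 ?exprn_ge0 //; lra.
  apply: le_trans (metric_triangle _ (u n.+1) _) _.
  rewrite addnS -addSn; apply: le_trans (lerD (ub n) (IH n.+1)) _.
  by rewrite le_eqVlt; apply/orP; left; apply/eqP; rewrite exprS; field; lra.
have b1' : `|b| < 1 by rewrite ger0_norm.
have /cvgrPdist_lt/(_ _ e0)[N _ /(_ N (leqnn _))] :=
  cvg_geometric (c / (1 - b)) b1'.
rewrite sub0r normrN => bN; exists (u N), N => // n /= Nn.
rewrite ballEmdist /= -(subnKC Nn); apply: le_lt_trans (tail _ _) _.
by apply: le_lt_trans bN; apply: le_trans (ler_norm _); rewrite mulrAC.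
Qed.

(** * Approximate Picard iteration *)

Section picard.
Context {R : realType} {X : metricType R}.
Implicit Types (F : X -> CB X) (x y : X) (q : nat -> X).

(** Since [F x] is closed, the fixed points of [F] are the zeros of the gap. *)
Definition gap F x : R := dist_set x (F x).

Lemma gap_ge0 F x : 0 <= gap F x.
Proof. exact/dist_set_ge0/CB_neq0. Qed.

Lemma dist_set_excess x (A B : CB X) :
  dist_set x B <= dist_set x A + excess A B.
Proof.
rewrite -lerBlDr; apply: dist_set_ge; first exact: CB_neq0.
move=> a Aa; rewrite lerBlDr.
apply: le_trans (dist_set_triangle x a (CB_neq0 B)) _.
by rewrite lerD2l excess_ge.
Qed.

Lemma excess_le_mdist (A B : CB X) : excess A B <= mdist A B.
Proof. by rewrite mdist_CBE /hausdorff_dist le_max lexx. Qed.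

Lemma gap_lipschitz F (a : R) x y :
  mdist (F x) (F y) <= a * mdist x y ->
  gap F y <= gap F x + (1 + a) * mdist x y.
Proof.
move=> Fxy; rewrite /gap.
have := dist_set_triangle y x (CB_neq0 (F y)).
have := dist_set_excess x (F x) (F y); have := excess_le_mdist (F x) (F y).
by rewrite (metric_sym y x); lra.
Qed.

Lemma gap_image F (a : R) x y : mdist (F x) (F y) <= a * mdist x y ->
  CB_set (F x) y -> gap F y <= a * mdist x y.
Proof.
move=> Fxy xy; apply: le_trans Fxy.
exact: le_trans (excess_ge (F y) xy) (excess_le_mdist _ _).
Qed.

(** For the exact Picard step one takes [y] in [F x] nearly realizing the gap at
    [x]; the slack [b - a] and the strictness of [gap F x < r] leave room to
    move [y] into the dense sequence. *)
Lemma picard_step F (a b r : R) x q :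
  0 <= a -> a < b -> dense_seq q ->
  (forall x y, mdist (F x) (F y) <= a * mdist x y) ->
  gap F x < r -> exists k, mdist x (q k) < r /\ gap F (q k) < b * r.
Proof.
move=> a0 ab qd Fa xr; have r0 := le_lt_trans (gap_ge0 F x) xr.
have [_ [y Fy <-] yr] := inf_lt (dist_set_has_inf x (CB_neq0 (F x))).1 xr.
have gy : gap F y <= a * mdist x y by exact: gap_image.
(* The first bound keeps [q k] within [r] of [x]; the second limits the growth
   of the gap from [y] to [q k], by [gap_lipschitz], to [(b - a) * r]. *)
have s0 : 0 < Num.min (r - mdist x y) ((b - a) * r / (1 + a)).
  by rewrite lt_min subr_gt0 yr divr_gt0 ?mulr_gt0 ?subr_gt0 //; lra.
have [k] := qd y _ s0; rewrite lt_min => /andP[yk].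
rewrite ltr_pdivlMr; last lra.
move=> yk'; exists k; split.
  by have := metric_triangle x y (q k); lra.
have := gap_lipschitz (Fa y (q k)).
have : a * mdist x y <= a * r by rewrite ler_wpM2l // ltW.
lra.
Qed.

Lemma fixed_point_lim F (a : R) (v : nat -> X) x :
  (forall x y, mdist (F x) (F y) <= a * mdist x y) -> 0 <= a ->
  v n @[n --> \oo] --> x -> gap F (v n) @[n --> \oo] --> (0 : R) ->
  CB_set (F x) x.
Proof.
move=> Fa a0 vx gv; apply: dist_set_closed; [exact: CB_neq0|exact: CB_closed|].
apply/ler_addgt0Pr => e e0; rewrite add0r.
have e1 : 0 < e / (2 + a) by rewrite divr_gt0 //; lra.
have [N vN] := cvg_mdist_exists vx e1.
have /cvgrPdist_lt/(_ _ e1)[M _ gM] := gv.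
have := vN _ (leq_maxl N M); have := gM _ (leq_maxr N M).
rewrite /= sub0r normrN ger0_norm ?gap_ge0 // => g1 g2.
have eE : e = e / (2 + a) + (1 + a) * (e / (2 + a)) by field; lra.
have := gap_lipschitz (Fa (v (maxn N M)) x); rewrite metric_sym => g3.
have : (1 + a) * mdist x (v (maxn N M)) <= (1 + a) * (e / (2 + a)).
  by rewrite ler_wpM2l ?ltW //; lra.
by rewrite -/(gap F x); lra.
Qed.

End picard.

(** * Measurability *)

Section measurability.
Context {d : measure_display} {Omega : measurableType d} {R : realType}.

Lemma measurable_fun_ltP (f : Omega -> R) :
  (forall r, measurable [set w | f w < r]) -> measurable_fun setT f.
Proof.
move=> mf _; apply: (measurability _ (RGenInftyO.measurableE R)) => //.
move=> _ [_ [r ->] <-]; rewrite setTI; have := mf r.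
by congr measurable; apply/seteqP; split => w; rewrite /= in_itv.
Qed.

(** The gap at [x] is less than [r] exactly when [T w x] meets the open ball of
    radius [r] around [x]. *)
Lemma measurable_gap (X : metricType R) (T : Omega -> X -> CB X) (x : X) :
  multi_random_operator (fun w x => T w x : set X) ->
  measurable_fun setT (fun w => gap (T w) x).
Proof.
move=> mT; apply: measurable_fun_ltP => r.
have := mT x _ (open_mdist_ball x r).
congr measurable; apply/seteqP; split => w /=.
  move=> [y [Ty]]; rewrite ballEmdist /=; exact: le_lt_trans (dist_set_le _ Ty).
move=> /(inf_lt (dist_set_has_inf x (CB_neq0 (T w x))).1)[_ [y Ty <-] xy].
by exists y; split => //; rewrite ballEmdist.
Qed.

(** For open [G], a limit lies in [G] exactly when, for some [m] and [N], all
    terms from rank [N] on lie in the closed set of centres of balls of radius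
    [m.+1%:R^-1] included in [G].  Requiring the terms merely to lie in [G]
    would not keep the limit away from the boundary of [G]. *)
Lemma random_element_cvg (X : metricType R) (u : nat -> Omega -> X)
    (l : Omega -> X) :
  (forall n, random_element (u n)) ->
  (forall w, u n w @[n --> \oo] --> l w) -> random_element l.
Proof.
move=> mu ul G oG.
pose C e := [set x | ball x e `<=` G].
have CE e : ~` C e = \bigcup_(z in ~` G) ball z e.
  apply/seteqP; split => x /=.
    move=> /existsNP[z /not_implyP[xz Gz]]; exists z => //.
    exact: ball_sym.
  by move=> [z Gz zx] /(_ z (ball_sym zx)).
have mC n (e : R) : measurable (u n @^-1` C e).
  have oC : open (~` C e).
    by rewrite CE; apply: bigcup_open => z _; exact: open_mdist_ball.
  by rewrite -[C e]setCK preimage_setC; apply: measurableC; exact: (mu n _ oC).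
rewrite (_ : l @^-1` G = \bigcup_m \bigcup_N \bigcap_n
    (u (N + n)%N @^-1` C m.+1%:R^-1)).
  apply: bigcupT_measurable => m; apply: bigcupT_measurable => N.
  by apply: bigcapT_measurable => n.
apply/seteqP; split => w /=.
  move=> Glw.
  have /nbhs_ballP[e /= e0 lG] : nbhs (l w) G by exact: open_nbhs_nbhs.
  have e2 : 0 < e / 2 by rewrite divr_gt0.
  have [m _ /(_ m (leqnn _)) /= me] := near_infty_natSinv_lt (PosNum e2).
  have [N uN] := cvg_mdist_exists (ul w) e2.
  exists m => //; exists N => // n _ y; rewrite ballEmdist /= => uy.
  apply: lG; rewrite ballEmdist /=.
  have := lt_trans uy me; have := uN _ (leq_addr n N).
  by have := metric_triangle (l w) (u (N + n)%N w) y; lra.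
move=> [m _ [N _ uG]].
have [|M uM] := @cvg_mdist_exists _ _ _ _ m.+1%:R^-1 (ul w).
  by rewrite invr_gt0.
apply: (uG M I); rewrite ballEmdist /= metric_sym; exact: uM (leq_addl _ _).
Qed.

(** The default [0] makes the selection total, hence measurable without
    knowing where the search succeeds. *)
Definition first_nat (P : pred nat) : nat :=
  if pselect (exists k, P k) is left exP then ex_minn exP else 0%N.

Lemma first_natP (P : pred nat) : (exists k, P k) -> P (first_nat P).
Proof.
by rewrite /first_nat => exP; case: pselect => // exP'; case: ex_minnP.
Qed.

Lemma first_nat_pred0 (P : pred nat) : (forall k, ~~ P k) -> first_nat P = 0%N.
Proof.
move=> P0; rewrite /first_nat; case: pselect => // -[k Pk].
by have := P0 k; rewrite Pk.
Qed.

Lemma measurable_first_nat (P : nat -> Omega -> bool) :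
  (forall k, measurable_fun setT (P k)) ->
  measurable_fun setT (fun w => first_nat (P^~ w)).
Proof.
move=> mP _ Y _; rewrite setTI.
have mPk k : measurable [set w | P k w].
  have := mP k measurableT [set true] I; rewrite setTI.
  by congr measurable; apply/seteqP; split.
(* [L k] is the event that [k] is the least index satisfying [P]. *)
pose L k := [set w | P k w] `\` \bigcup_(j < k) [set w | P j w].
have mL k : measurable (L k).
  by apply: measurableD => //; exact: bigcup_measurable.
rewrite (_ : _ @^-1` Y = (\bigcup_(k in Y) L k) `|`
    (~` (\bigcup_k [set w | P k w]) `&` [set _ | Y 0%N])).
  apply: measurableU; first exact: bigcup_measurable.
  apply: measurableI; first exact/measurableC/bigcupT_measurable.
  have [Y0|nY0] := pselect (Y 0%N).
    by rewrite (_ : [set _ | _] = setT) //; apply/seteqP; split.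
  by rewrite (_ : [set _ | _] = set0) //; apply/seteqP; split.
apply/seteqP; split => w; rewrite /= /first_nat; case: pselect => // exP.
- case: ex_minnP => k Pk kmin Yk; left; exists k => //; split => //.
  by move=> -[j /= jk Pj]; have := kmin _ Pj; rewrite leqNgt jk.
- by move=> Y0; right; split => // -[k _ Pk]; apply: exP; exists k.
- case: ex_minnP => k Pk kmin [[j Yj [Pj jmin]]|[nP _]]; last first.
    by case: nP; exists k.
  suff -> : k = j by [].
  apply/eqP; rewrite eqn_leq (kmin _ Pj) leqNgt /=.
  by apply/negP => kj; apply: jmin; exists k.
- by case=> [[j _ [Pj _]]|[]//]; case: exP; exists j.
Qed.

End measurability.

(** * Random Picard iteration *)

Section random_picard.
Context {R : realType} {X : completeMetricType R} {d : measure_display}.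
Context {Omega : measurableType d}.
Variables (T : Omega -> X -> CB X) (q : nat -> X) (D : set Omega).
Variables (a : Omega -> R).

Let b w : R := (1 + a w) / 2.
Let c w : R := gap (T w) (q 0) + 1.

(** The test [w \in D] freezes the iteration at [q 0] outside the set where the
    contraction property is known, so that the iterates converge for every
    [w]. *)
Fixpoint picard_index (n : nat) (w : Omega) : nat :=
  if n is m.+1 then
    first_nat (fun k => [&& w \in D,
      mdist (q (picard_index m w)) (q k) < c w * b w ^+ m &
      gap (T w) (q k) < c w * b w ^+ m.+1])
  else 0%N.

(** The current iterate enters the selection of the next one only through the
    [nat]-valued function [picard_index n], and every function on the discrete
    space [nat] is measurable; gaps are needed only at the fixed points
    [q k]. *)
Lemma measurable_picard_index n : measurable D -> measurable_fun setT a ->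
  multi_random_operator (fun w x => T w x : set X) ->
  measurable_fun setT (picard_index n).
Proof.
move=> mD ma mT; have mb : measurable_fun setT b.
  by apply: measurable_funM => //; apply: measurable_funD.
have mc : measurable_fun setT c.
  by apply: measurable_funD => //; exact: measurable_gap.
have mcb m : measurable_fun setT (fun w => c w * b w ^+ m).
  by apply: measurable_funM => //; exact: measurable_funX.
elim: n => [|n IH]; first exact: measurable_cst.
apply: measurable_first_nat => k; apply: measurable_and.
  apply: (measurable_fun_bool true); rewrite setTI; move: mD.
  congr measurable; apply/seteqP; split => w /=; first by move=> /mem_set.
  exact: set_mem.
apply: measurable_and; apply: measurable_fun_ltr => //.
  exact: (measurableT_comp (f := fun i => mdist (q i) (q k))).
exact: measurable_gap.
Qed.

Lemma picard_index_out w n : ~ D w -> picard_index n w = 0%N.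
Proof.
move=> nD; case: n => //= n; apply: first_nat_pred0 => k.
by rewrite (_ : w \in D = false) //; apply/negbTE/negP => /set_mem.
Qed.

Hypothesis dense_q : dense_seq q.
Hypothesis contr : forall w, D w ->
  0 <= a w < 1 /\ forall x y, mdist (T w x) (T w y) <= a w * mdist x y.

(** The bound on the gap is the invariant that lets [picard_step] produce an
    admissible next index, whose defining property restores the invariant. *)
Lemma picard_index_gap w n : D w ->
  gap (T w) (q (picard_index n w)) < c w * b w ^+ n /\
  mdist (q (picard_index n w)) (q (picard_index n.+1 w)) < c w * b w ^+ n.
Proof.
move=> Dw; have [/andP[a0 a1] Ta] := contr Dw.
have next m : gap (T w) (q (picard_index m w)) < c w * b w ^+ m ->
    [/\ w \in D,
      mdist (q (picard_index m w)) (q (picard_index m.+1 w)) < c w * b w ^+ m &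
      gap (T w) (q (picard_index m.+1 w)) < c w * b w ^+ m.+1].
  move=> gm; apply/and3P; pose admissible k := [&& w \in D,
    mdist (q (picard_index m w)) (q k) < c w * b w ^+ m &
    gap (T w) (q k) < c w * b w ^+ m.+1].
  apply: (@first_natP admissible).
  have [|k [dk gk]] := picard_step (b := b w) a0 _ dense_q Ta gm.
    by rewrite /b; lra.
  by exists k; apply/and3P; split; [exact: mem_set|exact: dk|
    rewrite exprS mulrCA; exact: gk].
suff gn : gap (T w) (q (picard_index n w)) < c w * b w ^+ n.
  by split => //; have [] := next _ gn.
elim: n => [|n IH]; last by have [] := next _ IH.
by rewrite expr0 mulr1 /c ltrDl.
Qed.

Lemma picard_index_cvg w : cvg (q (picard_index n w) @[n --> \oo]).
Proof.
have [Dw|nDw] := pselect (D w).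
  have [/andP[a0 a1] _] := contr Dw.
  apply: (@geometric_steps_cvg _ _ _ (b w) (c w)) => [|n].
    by rewrite /b; lra.
  by apply: ltW; have [] := picard_index_gap n Dw.
rewrite (_ : (fun n => _) = cst (q 0)); first exact: is_cvg_cst.
by apply/funext => n /=; rewrite picard_index_out.
Qed.

Definition picard_lim w : X := lim (q (picard_index n w) @[n --> \oo]).

Lemma picard_lim_fixed w : D w -> CB_set (T w (picard_lim w)) (picard_lim w).
Proof.
move=> Dw; have [/andP[a0 a1] Ta] := contr Dw.
apply: (fixed_point_lim Ta a0 (@picard_index_cvg w)).
have b1 : `|b w| < 1 by rewrite ger0_norm /b; lra.
apply: (squeeze_cvgr _ (cvg_cst 0) (cvg_geometric (c w) b1)).
apply: nearW => n; rewrite gap_ge0 /=.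
by apply: ltW; have [] := picard_index_gap n Dw.
Qed.

Lemma picard_lim_random : measurable D -> measurable_fun setT a ->
  multi_random_operator (fun w x => T w x : set X) -> random_element picard_lim.
Proof.
move=> mD ma mT.
apply: (random_element_cvg (u := fun n w => q (picard_index n w))) => [n G _|w].
  have := measurable_picard_index n mD ma mT measurableT (Y := q @^-1` G) I.
  by rewrite setTI.
exact: picard_index_cvg.
Qed.

End random_picard.

Lemma probability1_ae (R : realType) (d : measure_display)
    (Omega : measurableType d) (P : probability Omega R) (A : set Omega) :
  measurable A -> P A = 1%E -> {ae P, forall w, A w}.
Proof.
move=> mA PA; exists (~` A); split => //; first exact: measurableC.
by rewrite probability_setC // PA subee.
Qed.

Theorem corollary3p13 (R : realType) (X : completeMetricType R)
    (d : measure_display) (Omega : measurableType d) (P : probability Omega R)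
    (alpha : {RV P >-> R}) (T : Omega -> X -> CB X)
    (sepX : separable X)
    (alpha_ge0 : forall w, 0 <= alpha w)
    (alpha_lt1 : {ae P, forall w, 0 <= alpha w < 1})
    (T_random : multi_random_operator (fun w x => T w x : set X))
    (T_continuous : exists2 Omega0 : set Omega,
       measurable Omega0 /\ P Omega0 = 1%E &
       forall w, Omega0 w -> continuous (T w : X -> CB X))
    (Omega_xy_measurable : forall x y : X,
       measurable [set w | hausdorff_dist (T w x) (T w y)
                           <= alpha w * mdist x y])
    (Omega_xy_prob1 : forall x y : X,
       P [set w | hausdorff_dist (T w x) (T w y) <= alpha w * mdist x y]
       = 1%E) :
  exists x0 : Omega -> X,
    random_element x0 /\ {ae P, forall w, (T w (x0 w) : set X) (x0 w)}.
Proof.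
have [q dq] := separable_dense_seq sepX.
have [C [mC PC] cT] := T_continuous.
have ae_dense : {ae P, forall w, forall i j,
    mdist (T w (q i)) (T w (q j)) <= alpha w * mdist (q i) (q j)}.
  apply/ae_foralln => i; apply/ae_foralln => j.
  exact: (probability1_ae (Omega_xy_measurable (q i) (q j))).
have [N [mN PN0 NP]] : {ae P, forall w, 0 <= alpha w < 1 /\
    forall x y, mdist (T w x) (T w y) <= alpha w * mdist x y}.
  have ae0 := probability1_ae mC PC.
  apply: filterS3 alpha_lt1 ae0 ae_dense => w aw w0 Tq; split => //.
  apply: lipschitz_dense dq (cT w w0) Tq; by case/andP: aw.
have contr w : (~` N) w -> 0 <= alpha w < 1 /\
    forall x y, mdist (T w x) (T w y) <= alpha w * mdist x y.
  by move=> nNw; apply: contrapT => nw; exact/nNw/NP.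
exists (picard_lim T q (~` N) alpha); split.
  apply: picard_lim_random => //; exact: measurableC.
exists N; split => // w; apply: contra_notP => nNw.
exact: (picard_lim_fixed dq contr).
Qed.
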